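(* Let $n\ge 6$ be an integer, $q=2^n$, $a_1\in\mathbb{F}_q^{*}$, $a_2,b\in\mathbb{F}_{q^2}^{*}$ with $a_1\ne a_2$. For $i=1,2$ let $f_i(x)=\mathrm{Tr}_1^{2n}\!\left(\frac{a_i}{x^{q-1}+b}\right)$ for $x\in\mathbb{F}_{q^2}$, and let $h_2(x)=f_1(x)f_2(x)$. Then $h_2$ is bent if and only if one of the following conditions holds: (1) $b=1$, $\mathrm{Tr}_1^n(a_1)=1$ and $a_2\in\mathbb{F}_{q^2}^{*}\setminus\mathbb{F}_q^{*}$; (2) $b\in U\setminus\{1\}$, $\mathrm{Tr}_n^{2n}(a_2\overline{b})=0$, $\mathrm{Tr}_1^n(a_2\overline{a_2})=1$ and $h_2(0)=0$; (3) $b\in U\setminus\{1\}$, $\mathrm{Tr}_n^{2n}((a_1+a_2)\overline{b})=0$, $\mathrm{Tr}_1^n((a_1+a_2)(a_1+\overline{a_2}))=0$ and $h_2(0)=0$.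
   Context: For $k\mid m$, $\mathrm{Tr}_k^{m}(x)=x+x^{2^k}+\cdots+x^{2^{(m/k-1)k}}$ is the trace from $\mathbb{F}_{2^m}$ to $\mathbb{F}_{2^k}$. For $x\in\mathbb{F}_{q^2}$ write $\overline{x}=x^{q}$. The unit circle is $U=\{\eta\in\mathbb{F}_{q^2}:\eta^{q+1}=1\}$. Division by zero is interpreted with the convention $\frac{1}{0}=0$. A Boolean function $f:\mathbb{F}_{2^{m}}\to\mathbb{F}_2$ is bent if its Walsh transform $W_f(\omega)=\sum_{x\in\mathbb{F}_{2^m}}(-1)^{f(x)+\mathrm{Tr}_1^m(\omega x)}$ satisfies $W_f(\omega)^2=2^m$ for all $\omega\in\mathbb{F}_{2^m}$. *)

(* Defs.v *)
From mathcomp Require Import all_boot all_order all_algebra all_field.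
Set Implicit Arguments. Unset Strict Implicit. Unset Printing Implicit Defensive.
Import GRing.Theory.
Local Open Scope ring_scope.

(* Relative trace: for K a field containing F_{2^(k*N)},
   trK k N x = x + x^(2^k) + ... + x^(2^(k(N-1)))  = Tr_k^{kN}(x). *)
Definition trK (K : fieldType) (k N : nat) (x : K) : K :=
  \sum_(i < N) x ^+ (2 ^ (k * i)).

(* Walsh transform of f : F_{2^m} -> F_2 (F_2 values encoded as bool),
   where K is the field F_{2^m}: W_f(w) = sum_x (-1)^(f x + Tr_1^m(w x)). *)
Definition walsh (K : finFieldType) (m : nat) (f : K -> bool) (w : K) : int :=
  \sum_(x : K) (-1) ^+ (f x (+) (trK 1 m (w * x) == 1)).

Definition bent (K : finFieldType) (m : nat) (f : K -> bool) : Prop :=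
  forall w : K, (walsh m f w) ^+ 2 = (2 ^ m)%:R.

(* f_a(x) = Tr_1^{2n}( a / (x^(q-1) + b) ), q = 2^n, with 1/0 = 0
   (MathComp's inverse satisfies 0^-1 = 0). *)
Definition fab (K : finFieldType) (n : nat) (a b : K) (x : K) : bool :=
  trK 1 (2 * n) (a / (x ^+ (2 ^ n - 1) + b)) == 1.

(* Main.v *)
(* The function h_2 is constant on the cosets of F_q^*, so its Walsh transform is
   governed by the single integer S, the sum of (-1)^h_2 over the unit circle U
   (reading h_2 as a function of u = x^(q-1)): h_2 is bent iff S = (-1)^h_2(0).
   Moreover 2 S = q + 1 + S(a_1) + S(a_2) - S(a_1 + a_2) with
   S(a) = sum_(u in U) chi(a / (u + b)).

   If b lies on U, then u |-> 1/(u + b) maps U minus b onto an affine F_q-line, each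
   S(a) is 1 or 1 +- q, and the three conditions come from comparing signs.

   If b is off U, the same map carries U to another circle, so |S(a)| = |T(w)| for
   some w != 0, where T(w) = sum_(u in U) chi(w u), and bentness would force some
   3 |T(w)| >= q - 1.  Instead of the Weil bound we use moments: the second and
   fourth moments of T bound sum_(w != 0) (T(w)^2 - q)^2, and since T is constant on
   the cosets w U this suffices for q >= 128.  For q = 64 the Frobenius invariance
   T(w^2) = T(w) doubles the multiplicity when w is not in U, while T(1) is
   controlled by the sizes of the orbits of squaring on the 65 elements of U. *)
Require Import Defs.
From mathcomp Require Import all_boot all_order all_algebra all_field.
From mathcomp Require Import cyclic zify ring.
Set Implicit Arguments. Unset Strict Implicit. Unset Printing Implicit Defensive.
Import Order.TTheory GRing.Theory Num.Theory.
Local Open Scope ring_scope.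

(** * Integer inequalities and a count modulo 65 *)

Lemma eq_opp_int0 (x : int) : x = - x -> x = 0.
Proof. by lia. Qed.

(** Meant for a Walsh value at 0: [(Q - 1) * s] is at most Q + 1 in absolute value, so |s| <= 1 once
    Q >= 4, and neither s = 0 nor s = -e fits. *)
Lemma eq_of_scaled_sum (Q s e : int) :
    4 <= Q -> e = 1 \/ e = -1 -> (e + (Q - 1) * s) ^+ 2 = Q ^+ 2 -> s = e.
Proof.
move=> Q4 eE /eqP; rewrite eqf_sqr => W.
have {}W : (Q - 1) * s = Q - e \/ (Q - 1) * s = - Q - e.
  by case/orP: W => /eqP W; [left|right]; lia.
have [s2|[s2|[-> //|[s0|s0]]]] : 2 <= s \/ s <= -2 \/ s = e \/ s = 0 \/ s = - e by lia.
- have : (Q - 1) * 2 <= (Q - 1) * s by rewrite ler_wpM2l //; lia.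
  by lia.
- have : (Q - 1) * s <= (Q - 1) * -2 by rewrite ler_wpM2l //; lia.
  by lia.
- by rewrite s0 in W *; lia.
- by rewrite s0 in W *; case: eE W => ->; lia.
Qed.

(** This will contradict the variance bound on [kl]. It already fails at Q = 64, t = 21, where 377^2
    < 64^3, so n = 6 needs a separate argument. *)
Lemma sqr_gap (Q t : int) : 128 <= Q -> 0 <= t -> Q - 1 <= 3 * t ->
  Q ^+ 3 < (t ^+ 2 - Q) ^+ 2.
Proof.
move=> Q128 t0 Qt.
have t2 : (Q - 1) ^+ 2 <= 9 * t ^+ 2 by nia.
(* From (Q - 1)^2 - 9 Q = Q (Q - 11) + 1, with 117 = 128 - 11. *)
have d1 : 117 * Q <= 9 * (t ^+ 2 - Q) by nia.
have d2 : 117 * Q ^+ 2 <= 128 * (9 * (t ^+ 2 - Q)) by nia.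
have d3 : (117 * Q ^+ 2) * (117 * Q ^+ 2) <=
   (128 * (9 * (t ^+ 2 - Q))) * (128 * (9 * (t ^+ 2 - Q))) by apply: ler_pM => //; nia.
have d4 : 128 * Q ^+ 3 <= Q ^+ 4 by rewrite exprS ler_wpM2r //; nia.
have d5 : 0 < Q ^+ 3 by rewrite exprn_gt0 //; lia.
move: d3 d4 d5; move: (t ^+ 2 - Q) => d.
by rewrite !expr2 !exprS expr0 mulr1; nia.
Qed.

(* Under doubling, Z/65 splits into {0}, the orbit of 13 (size 4) and five orbits of size 12. *)
Lemma doubling_orbits_mod65 (f : nat -> int) :
    (forall i, f (i %% 65)%N = f i) -> (forall i, f (2 * i)%N = f i) ->
  \sum_(i < 65) f i = f 0%N + 4 * f 13%N + 12 * (f 1%N + f 3%N + f 5%N + f 7%N + f 11%N).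
Proof.
move=> f65 f2; pose orb m r := [seq (2 ^ k * r %% 65)%N | k <- iota 0 m].
have sum_orb m r : \sum_(i <- orb m r) f i = m%:Z * f r.
  rewrite big_map (eq_bigr (fun=> f r)) => [|k _].
    by rewrite big_const_seq count_predT size_iota iter_addr_0 -mulr_natl natz.
  by rewrite f65; elim: k => [|k IH]; rewrite ?mul1n // expnS -mulnA f2.
rewrite -(big_mkord xpredT) /index_iota subn0.
rewrite (perm_big (orb 1 0 ++ orb 4 13 ++ orb 12 1 ++ orb 12 3 ++ orb 12 5 ++ orb 12 7
  ++ orb 12 11)%N); last by vm_compute.
by rewrite !big_cat /= !sum_orb; lia.
Qed.

(** * Traces in characteristic 2 *)

Section Trace.
Variables (K : finFieldType) (char2 : 2%N \in [pchar K]).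

Lemma pchar2_expD (k : nat) (x y : K) :
  (x + y) ^+ (2 ^ k) = x ^+ (2 ^ k) + y ^+ (2 ^ k).
Proof. by apply: exprDn_pchar; rewrite pnatX pnatE ?char2. Qed.

Lemma pchar2_exp_sum (k : nat) (I : Type) (r : seq I) (P : pred I) (F : I -> K) :
  (\sum_(i <- r | P i) F i) ^+ (2 ^ k) = \sum_(i <- r | P i) F i ^+ (2 ^ k).
Proof.
apply: (big_morph (fun x => x ^+ (2 ^ k)) (pchar2_expD k)).
by rewrite expr0n expn_eq0.
Qed.

Lemma trKD (k N : nat) (x y : K) : trK k N (x + y) = trK k N x + trK k N y.
Proof. by rewrite /trK -big_split /=; apply: eq_bigr => i _; rewrite pchar2_expD. Qed.

(** Squaring shifts the terms cyclically, the last one returning to x. *)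
Lemma trK_sqr (N : nat) (x : K) : x ^+ (2 ^ N) = x -> trK 1 N (x ^+ 2) = trK 1 N x.
Proof.
case: N => [|N]; first by rewrite /trK !big_ord0.
move=> xN; rewrite /trK big_ord_recr big_ord_recl /= addrC.
rewrite -exprM -expnS !mul1n xN expn0 expr1; congr (_ + _).
by apply: eq_bigr => i _; rewrite -exprM -expnS /bump /= !mul1n.
Qed.

Lemma trK_01 (N : nat) (x : K) :
  x ^+ (2 ^ N) = x -> trK 1 N x = 0 \/ trK 1 N x = 1.
Proof.
move=> xN; have : trK 1 N x ^+ 2 = trK 1 N x.
  rewrite -[RHS](trK_sqr xN) /trK -[in LHS](expn1 2) pchar2_exp_sum.
  by apply: eq_bigr => i _; rewrite expn1 -!exprM mulnC.
move/eqP; rewrite expr2 -subr_eq0 -{3}[trK 1 N x]mulr1 -mulrBr mulf_eq0 subr_eq0.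
by case/orP=> /eqP ->; [left|right].
Qed.

(** Transitivity of the trace, by cutting the 2n terms at n. *)
Lemma trK_double (n : nat) (x : K) : trK 1 (2 * n) x = trK 1 n (x + x ^+ (2 ^ n)).
Proof.
rewrite trKD /trK mul2n -addnn big_split_ord /=; congr (_ + _).
by apply: eq_bigr => i _; rewrite !mul1n -exprM -expnD.
Qed.

End Trace.

(** * Roots of unity in a finite field *)

Section UnityRoots.
Variable K : finFieldType.

Lemma finField_prim_root : exists g : K, #|K|.-1.-primitive_root g.
Proof.
have K1 := finNzRing_gt1 K.
suff /hasP[g _ ?] : has #|K|.-1.-primitive_root (enum (predC1 (0 : K))) by exists g.
apply: has_prim_root; rewrite ?enum_uniq -?cardE ?cardC1 //; first by rewrite ltn_predRL.
apply/allP => x; rewrite mem_enum inE unity_rootE => x0.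
by rewrite -(inj_eq (mulfI x0)) -exprS prednK ?expf_card ?mulr1 // ltnW.
Qed.

Lemma finField_dvd_prim_root (d : nat) :
  (d %| #|K|.-1)%N -> exists g : K, d.-primitive_root g.
Proof. by move=> dK; have [g gP] := finField_prim_root; eexists; apply: (dvdn_prim_root gP) dK. Qed.

Lemma card_unity_roots (d : nat) :
  (d %| #|K|.-1)%N -> #|[set x : K | x ^+ d == 1]| = d.
Proof.
move=> dK; have [g gP] := finField_dvd_prim_root dK.
have -> : [set x : K | x ^+ d == 1] = [set g ^+ (i : 'I_d) | i : 'I_d].
  apply/setP => x; rewrite inE; apply/eqP/imsetP.
    by move=> /(prim_rootP gP)[i ->]; exists i.
  by move=> [i _ ->]; rewrite exprAC (prim_expr_order gP) expr1n.
rewrite card_imset ?card_ord // => i j /eqP.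
by rewrite (eq_prim_root_expr gP) !modn_small // => /eqP/val_inj.
Qed.

End UnityRoots.
Lemma sum_inj_in (T : finType) (A : {set T}) (f : T -> T) (F : T -> int) :
    {in A &, injective f} -> {in A, forall x, f x \in A} ->
  \sum_(x in A) F (f x) = \sum_(x in A) F x.
Proof.
move=> fI fA; have E : f @: A = A.
  apply/eqP; rewrite eqEcard card_in_imset // leqnn andbT.
  by apply/subsetP => _ /imsetP[x xA ->]; apply: fA.
by rewrite -[in RHS]E big_imset.
Qed.

Lemma sum_const_set (T : finType) (A : {set T}) (F : T -> int) (c : int) :
  {in A, forall x, F x = c} -> \sum_(x in A) F x = #|A|%:Z * c.
Proof.
move=> Fc; rewrite (eq_bigr (fun=> c)) // sumr_const -mulr_natl.
by rewrite natz.
Qed.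

(** * The subfield F_q, the unit circle and the additive character of F_{q^2} *)

Section Character.
Variables (K : finFieldType) (n : nat).
Hypotheses (hK : #|K| = (2 ^ (2 * n))%N) (n_gt0 : (0 < n)%N).

Local Notation q := (2 ^ n)%N.

(** The canonical additive character of F_{q^2}. *)
Definition chi (x : K) : int := (-1) ^+ (trK 1 (2 * n) x == 1).

Definition unitCircle : {set K} := [set u | u ^+ (q + 1) == 1].
Definition subFq : {set K} := [set y | y ^+ q == y].

Local Notation U := unitCircle.
Local Notation Fq := subFq.

Lemma char2 : 2%N \in [pchar K].
Proof. exact: card_finPcharP hK _. Qed.

Lemma addxx (x : K) : x + x = 0. Proof. exact: addrr_pchar2 char2 x. Qed.
Lemma oppx (x : K) : - x = x. Proof. exact: oppr_pchar2 char2 x. Qed.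
Lemma addx_eq0 (x y : K) : (x + y == 0) = (x == y).
Proof. by rewrite addr_eq0 oppx. Qed.
Lemma addKx (x y : K) : x + (x + y) = y. Proof. by rewrite addrA addxx add0r. Qed.

Lemma conjD (x y : K) : (x + y) ^+ q = x ^+ q + y ^+ q.
Proof. exact: pchar2_expD char2 _ _ _. Qed.

Lemma conjK (x : K) : x ^+ q ^+ q = x.
Proof. by rewrite -exprM -expnD addnn -mul2n -hK expf_card. Qed.

Lemma q_gt1 : (1 < q)%N.
Proof. by rewrite -[1%N](expn0 2) ltn_exp2l. Qed.

Lemma card_predE : #|K|.-1 = ((q - 1) * (q + 1))%N.
Proof. by rewrite hK mul2n -addnn expnD; have := q_gt1; nia. Qed.

Lemma card_unitCircle : #|U| = (q + 1)%N.
Proof. by apply: card_unity_roots; rewrite card_predE dvdn_mull. Qed.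

Lemma card_Fq_units : #|[set y : K | y ^+ (q - 1) == 1]| = (q - 1)%N.
Proof. by apply: card_unity_roots; rewrite card_predE dvdn_mulr. Qed.

Lemma Fq_unitsE (y : K) : (y ^+ (q - 1) == 1) = (y != 0) && (y \in Fq).
Proof.
have q1 := q_gt1; rewrite inE; have [->|y0] /= := eqVneq y 0.
  by rewrite expr0n subn_eq0 leqNgt q1 eq_sym oner_eq0.
by rewrite -(inj_eq (mulfI y0)) -exprS subn1 prednK ?mulr1 //; lia.
Qed.

Lemma Fq0 : 0 \in Fq.
Proof. by rewrite inE expr0n expn_eq0. Qed.

Lemma FqD x y : x \in Fq -> y \in Fq -> x + y \in Fq.
Proof. by rewrite !inE conjD => /eqP -> /eqP ->. Qed.

Lemma FqM x y : x \in Fq -> y \in Fq -> x * y \in Fq.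
Proof. by rewrite !inE exprMn => /eqP -> /eqP ->. Qed.

Lemma FqV x : x \in Fq -> x^-1 \in Fq.
Proof. by rewrite !inE exprVn => /eqP ->. Qed.

Lemma Fq_trace (x : K) : x + x ^+ q \in Fq.
Proof. by rewrite inE conjD conjK addrC. Qed.

Lemma card_Fq : #|Fq| = q.
Proof.
rewrite (cardsD1 0) Fq0 (_ : Fq :\ 0 = [set y | y ^+ (q - 1) == 1]).
  by rewrite card_Fq_units subnKC //; have := q_gt1; lia.
by apply/setP => y; rewrite !inE Fq_unitsE inE.
Qed.

Lemma unitCircleE u : (u \in U) = (u * u ^+ q == 1).
Proof. by rewrite inE addn1 exprS. Qed.

Lemma unitCircle_neq0 u : u \in U -> u != 0.
Proof. by rewrite unitCircleE; apply: contraTneq => ->; rewrite mul0r eq_sym oner_eq0. Qed.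

Lemma unitCircle_conj u : u \in U -> u ^+ q = u^-1.
Proof.
by move=> uU; apply: (mulfI (unitCircle_neq0 uU)); rewrite divff ?unitCircle_neq0 //;
   apply/eqP; rewrite -unitCircleE.
Qed.

Lemma unitCircleM u v : u \in U -> v \in U -> u * v \in U.
Proof. by rewrite !inE exprMn => /eqP -> /eqP ->; rewrite mulr1. Qed.

Lemma unitCircleV u : u \in U -> u^-1 \in U.
Proof. by rewrite !inE exprVn => /eqP ->; rewrite invr1. Qed.

Lemma unitCircle1 : 1 \in U.
Proof. by rewrite inE expr1n. Qed.

Lemma Fq_unitCircle u : u \in U -> u \in Fq -> u = 1.
Proof.
rewrite unitCircleE inE => /eqP uu /eqP uq; move: uu; rewrite uq -expr2 => /eqP.
by rewrite sqrf_eq1 oppx orbb => /eqP.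
Qed.

Lemma tr_01 (x : K) : trK 1 (2 * n) x = 0 \/ trK 1 (2 * n) x = 1.
Proof. by apply: (trK_01 char2); rewrite -hK expf_card. Qed.

Lemma tr_n_01 x : x \in Fq -> trK 1 n x = 0 \/ trK 1 n x = 1.
Proof. by rewrite inE => /eqP; apply: (trK_01 char2). Qed.

Lemma chi_pm x : chi x = 1 \/ chi x = -1.
Proof. by rewrite /chi; case: eqP; [right|left]. Qed.

Lemma normr_chi x : `|chi x| = 1.
Proof. exact: normr_sign. Qed.

Lemma trK0 k N : trK k N (0 : K) = 0.
Proof. by rewrite /trK big1 // => i _; rewrite expr0n expn_eq0. Qed.

Lemma chi0 : chi 0 = 1.
Proof. by rewrite /chi trK0 eq_sym oner_eq0. Qed.

Lemma chiD x y : chi (x + y) = chi x * chi y.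
Proof.
rewrite /chi (trKD char2).
by case: (tr_01 x) => ->; case: (tr_01 y) => ->;
  rewrite ?addr0 ?add0r ?addxx ?eqxx ?(eq_sym 0) ?oner_eq0.
Qed.

Lemma chi_sqr x : chi (x ^+ 2) = chi x.
Proof. by rewrite /chi (trK_sqr _) // -hK expf_card. Qed.

Lemma chi_conj x y : x + x ^+ q = y + y ^+ q -> chi x = chi y.
Proof. by move=> e; rewrite /chi !(trK_double char2) e. Qed.

Lemma chi_Fq x : x \in Fq -> chi x = 1.
Proof. by rewrite inE => /eqP e; rewrite /chi (trK_double char2) e addxx trK0 eq_sym oner_eq0. Qed.

(** Otherwise the trace polynomial, of degree below q^2, would vanish at all q^2 elements of the
    field. *)
Lemma chi_nontrivial : exists z, chi z = -1.
Proof.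
have [/existsP[z /eqP zE]|/existsPn none] := boolP [exists z, chi z == -1]; first by exists z.
pose p : {poly K} := \sum_(i < 2 * n) 'X^(2 ^ (1 * i)).
have pz z : root p z.
  rewrite rootE horner_sum; apply/eqP; transitivity (trK 1 (2 * n) z).
    by apply: eq_bigr => i _; rewrite hornerXn.
  case: (tr_01 z) => // e; move: (none z).
  by rewrite /chi e eqxx.
have p0 : p != 0.
  apply/eqP => /(congr1 (fun p : {poly K} => p`_1)); rewrite coef_sum coef0.
  have n2 : (0 < 2 * n)%N by lia.
  (* The coefficient of X comes from the index 0 alone and equals 1. *)
  rewrite (bigD1 (Ordinal n2)) //= coefXn eqxx big1 ?addr0 => [/eqP|i i0].
    by rewrite oner_eq0.
  rewrite coefXn mul1n -[X in X == _](expn0 2) eqn_exp2l // eq_sym.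
  by move: i0; rewrite -val_eqE /= => /negPf ->.
have := max_poly_roots p0 (rs := enum K).
rewrite enum_uniq -cardE hK => /(_ _ isT).
have -> : all (root p) (enum K) by apply/allP => z _.
move=> /(_ isT); rewrite ltnNge => /negP[].
apply: leq_trans (size_sum _ _ _) _; apply/bigmax_leqP => i _.
by rewrite size_polyXn mul1n ltn_exp2l.
Qed.

(** Orthogonality: for w != 0, translating x by z / w with [chi z = -1] negates the sum. *)
Lemma sum_chi w : \sum_x chi (w * x) = if w == 0 then (q ^ 2)%N%:Z else 0.
Proof.
case: eqVneq => [->|w0].
  rewrite (eq_bigr (fun=> 1)) => [|i _]; last by rewrite mul0r chi0.
  by rewrite sumr_const hK -mulr_natl mulr1 natz -expnM mulnC.
have [z zE] := chi_nontrivial.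
apply: eq_opp_int0.
rewrite {1}(reindex_inj (addrI (z / w))) /= -mulN1r mulr_sumr.
by apply: eq_bigr => x _; rewrite mulrDr mulrCA divff // mulr1 chiD zE.
Qed.

(* Trace one over F_q pulls back to trace one over F_q^2 because
   Tr(w y) = Tr_n(y (w + conj w)) for y in F_q. *)
Lemma chi_Fq_nontrivial w : w \notin Fq -> exists2 y, y \in Fq & chi (w * y) = -1.
Proof.
move=> wF; have [z zE] := chi_nontrivial.
have ww0 : w + w ^+ q != 0 by rewrite addx_eq0 eq_sym; rewrite inE in wF.
have yF : (z + z ^+ q) / (w + w ^+ q) \in Fq by rewrite FqM ?FqV ?Fq_trace.
exists ((z + z ^+ q) / (w + w ^+ q)) => //.
rewrite -zE; apply: chi_conj; rewrite exprMn.
by move: yF; rewrite inE => /eqP ->; rewrite -mulrDl mulrCA divff // mulr1.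
Qed.

Lemma sum_chi_Fq w : \sum_(y in Fq) chi (w * y) = if w \in Fq then q%:Z else 0.
Proof.
case: ifPn => wF.
  rewrite (@sum_const_set _ _ _ 1) ?card_Fq ?mulr1 // => y yF.
  by rewrite chi_Fq // FqM.
have [z zF zE] := chi_Fq_nontrivial wF.
apply: eq_opp_int0.
rewrite -{1}(@sum_inj_in _ _ (+%R z)).
- rewrite -mulN1r mulr_sumr.
  by apply: eq_bigr => x _; rewrite mulrDr chiD zE.
- by move=> x y _ _ /addrI.
- by move=> y; apply: FqD.
Qed.

(** * The map x -> x^(q-1) onto the circle, and the Walsh transform *)

Lemma expr_q1_unitCircle x : x != 0 -> x ^+ (q - 1) \in U.
Proof.
move=> x0; rewrite inE -exprM -card_predE; apply/eqP/(mulfI x0).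
by rewrite -exprS prednK ?expf_card ?mulr1 // ltnW // finNzRing_gt1.
Qed.

(** A nonempty fibre is a coset of the group of (q-1)-th roots of unity. No fibre over U is empty,
    since the (q-1)-th power of a generator is a primitive (q+1)-th root of unity. *)
Lemma card_expr_q1_fiber u : u \in U -> #|[set x | x ^+ (q - 1) == u]| = (q - 1)%N.
Proof.
have q1 : (0 < q - 1)%N by rewrite subn_gt0 q_gt1.
move=> uU; have [x0 x0E] : exists x0, x0 ^+ (q - 1) = u.
  have [g gP] := finField_prim_root K; rewrite card_predE in gP.
  have := dvdn_prim_root gP (dvdn_mull (q - 1) (dvdnn (q + 1))).
  rewrite mulnK ?addn1 // -addn1 => gqP.
  move: uU; rewrite inE => /eqP /(prim_rootP gqP)[i ->].
  by exists (g ^+ i); rewrite exprAC.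
have x0n : x0 != 0.
  by apply: contraTneq (unitCircle_neq0 uU) => z; rewrite -x0E z expr0n (gtn_eqF q1) eqxx.
rewrite -[RHS]card_Fq_units -[RHS](card_imset _ (mulfI x0n)).
congr #|pred_of_set _|; apply/setP => x; rewrite inE; apply/eqP/imsetP => [xE|[y]].
  exists (x / x0); last by rewrite mulrCA divff ?mulr1.
  by rewrite inE exprMn exprVn xE x0E divff ?unitCircle_neq0.
by rewrite inE => /eqP yE ->; rewrite exprMn yE x0E mulr1.
Qed.

Lemma sum_expr_q1 (F : K -> int) :
  \sum_(x | x != 0) F (x ^+ (q - 1)) = (q - 1)%N%:Z * \sum_(u in U) F u.
Proof.
rewrite (partition_big (fun x => x ^+ (q - 1)) (mem U)) /=; last exact: expr_q1_unitCircle.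
rewrite mulr_sumr; apply: eq_bigr => u uU.
transitivity (\sum_(x in [set x | x ^+ (q - 1) == u]) F (x ^+ (q - 1))).
  apply: eq_bigl => x; rewrite inE andb_idl // => /eqP xu.
  apply/negP => /eqP x0; case/negP: (unitCircle_neq0 uU).
  by rewrite -xu x0 expr0n subn_eq0 leqNgt q_gt1.
rewrite (@sum_const_set _ _ _ (F u)) ?card_expr_q1_fiber // => x.
by rewrite inE => /eqP ->.
Qed.

Section Walsh.
Variables (h G : K -> bool).
Hypothesis hG : forall x, x != 0 -> h x = G (x ^+ (q - 1)).

Definition circleSum (G : K -> bool) : int := \sum_(u in U) (-1) ^+ G u.

Let S := circleSum G.

Lemma walsh_split w :
  walsh (2 * n) h w = (-1) ^+ h 0 + \sum_(x | x != 0) (-1) ^+ G (x ^+ (q - 1)) * chi (w * x).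
Proof.
rewrite /walsh (bigD1 0) //= mulr0 trK0 [0 == 1]eq_sym oner_eq0 addbF; congr (_ + _).
by apply: eq_bigr => x x0; rewrite signr_addb hG.
Qed.

Lemma walsh_at0 : walsh (2 * n) h 0 = (-1) ^+ h 0 + (q - 1)%N%:Z * S.
Proof.
rewrite walsh_split -(sum_expr_q1 (fun u => (-1) ^+ G u)); congr (_ + _).
by apply: eq_bigr => x _; rewrite mul0r chi0 mulr1.
Qed.

(* Averaging over x -> x y with y in F_q^* replaces chi(w x) by a full sum over F_q. *)
Lemma walsh_neq0 w : w != 0 ->
  walsh (2 * n) h w = (-1) ^+ h 0 - S + q%:Z * (-1) ^+ G (w^-1 ^+ (q - 1)).
Proof.
move=> w0; have q1 := q_gt1; rewrite walsh_split -addrA; congr (_ + _).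
pose F x : int := (-1) ^+ G (x ^+ (q - 1)).
set A := \sum_(x | _) _; have Ay y : y \in Fq :\ 0 -> A = \sum_(x | x != 0) F x * chi (w * x * y).
  rewrite !inE => /andP[y0 yF]; rewrite /A (reindex_inj (mulIf y0)) /=.
  apply: eq_big => x; first by rewrite mulf_eq0 (negPf y0) orbF.
  move=> _; rewrite /F exprMn [y ^+ _](_ : _ = 1) ?mulr1 ?mulrA //.
  by apply/eqP; rewrite Fq_unitsE y0 inE.
have : (q - 1)%N%:Z * A = \sum_(x | x != 0) F x * \sum_(y in Fq :\ 0) chi (w * x * y).
  rewrite -card_Fq (cardsD1 0 Fq) Fq0 addKn -(@sum_const_set _ _ (fun=> A)) //.
  rewrite (eq_bigr _ Ay) exchange_big /=; apply: eq_bigr => x _.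
  by rewrite mulr_sumr.
have inner x : \sum_(y in Fq :\ 0) chi (w * x * y) = (if w * x \in Fq then q%:Z else 0) - 1.
  by rewrite -sum_chi_Fq [in RHS](big_setD1 0) ?Fq0 //= mulr0 chi0 addrAC subrr add0r.
under eq_bigr do rewrite inner mulrBr mulr1.
rewrite sumrB (sum_expr_q1 (fun u => (-1) ^+ G u)) -/(circleSum G) -/S.
have -> : \sum_(x | x != 0) F x * (if w * x \in Fq then q%:Z else 0) =
          q%:Z * ((q - 1)%N%:Z * (-1) ^+ G (w^-1 ^+ (q - 1))).
  have wU : w^-1 ^+ (q - 1) \in U by rewrite expr_q1_unitCircle ?invr_eq0.
  have <- : \sum_(x in [set x | x ^+ (q - 1) == w^-1 ^+ (q - 1)]) F x =
            (q - 1)%N%:Z * (-1) ^+ G (w^-1 ^+ (q - 1)).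
    rewrite (@sum_const_set _ _ _ ((-1) ^+ G (w^-1 ^+ (q - 1)))) ?card_expr_q1_fiber // => x.
    by rewrite inE /F => /eqP ->.
  rewrite mulr_sumr [RHS]big_mkcond /= big_mkcond /=; apply: eq_bigr => x _.
  (* For x != 0, w x lies in F_q exactly when x and 1/w have the same (q-1)-th power, so a single
     fibre survives. *)
  have -> : (x \in [set x | x ^+ (q - 1) == w^-1 ^+ (q - 1)]) = (x != 0) && (w * x \in Fq).
    have -> : (x != 0) = (w * x != 0) by rewrite mulf_eq0 negb_or w0.
    rewrite -Fq_unitsE inE exprMn exprVn -(inj_eq (mulfI (expf_neq0 (q - 1) w0))).
    by rewrite divff ?expf_neq0.
  by case: (x != 0); case: (w * x \in Fq); rewrite //= ?mulr0 // mulrC.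
move=> E; apply: (@mulfI _ (q - 1)%N%:Z); first by lia.
rewrite E; ring.
Qed.

(** The Walsh value at 0 alone forces S. Conversely, this S cancels the constant term at every w !=
    0 and leaves q or -q. *)
Lemma bent_circleSum : (1 < n)%N -> bent (2 * n) h <-> S = (-1) ^+ h 0.
Proof.
move=> n1; have q4 : (4 <= q)%N by rewrite -[4%N]/(2 ^ 2)%N leq_exp2l.
have qq : (2 ^ (2 * n))%:R = q%:Z ^+ 2 :> int by rewrite natz mulnC expnM PoszM.
rewrite /bent; split => [/(_ 0)|SE w].
  rewrite walsh_at0 qq -subzn ?(ltnW q_gt1) //; apply: eq_of_scaled_sum => //.
  by case: (h 0); [right|left].
rewrite qq; have [->|w0] := eqVneq w 0.
  rewrite walsh_at0 SE (_ : _ + _ = q%:Z * (-1) ^+ h 0); last by case: (h 0) => /=; lia.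
  by rewrite exprMn sqrr_sign mulr1.
by rewrite walsh_neq0 // SE subrr add0r exprMn sqrr_sign mulr1.
Qed.

End Walsh.

(** * Character sums of a / (u + b) over the circle *)

Lemma sum_pole_on_circle a b : b \in U ->
  \sum_(u in U) chi (a / (u + b)) =
    1 + (if a * b ^+ q \in Fq then q%:Z * (-1) ^+ (trK 1 n (a * b ^+ q) == 1) else 0).
Proof.
move=> bU; have b0 := unitCircle_neq0 bU; have bq := unitCircle_conj bU.
(* The leading 1 is the term u = b, where 1/0 = 0. *)
rewrite (big_setD1 b) //= addxx invr0 mulr0 chi0; congr (_ + _).
(* For u != b, t runs over the line t + t^q = 1, a translate of F_q. If A is in F_q, then Tr(A t) =
   Tr_n(A) is constant on it; otherwise a translation along F_q negates the sum. *)
set A := a * b ^+ q; pose t u := b / (u + b).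
have tE u : a / (u + b) = A * t u by rewrite /A /t bq mulrA mulfVK.
have tD u : u \in U :\ b -> t u + t u ^+ q = 1.
  rewrite in_setD1 => /andP[ub uU]; have u0 := unitCircle_neq0 uU.
  have ub0 : u + b != 0 by rewrite addx_eq0.
  have bu0 : b + u != 0 by rewrite addrC.
  rewrite /t exprMn exprVn conjD bq (unitCircle_conj uU); field.
  by rewrite ?u0 ?b0 ?bu0 ?ub0.
under eq_bigr do rewrite tE.
case: ifPn => AF.
  rewrite (@sum_const_set _ _ _ ((-1) ^+ (trK 1 n A == 1))).
    by have := card_unitCircle; rewrite (cardsD1 b) bU add1n addn1 => -[->].
  move=> u /tD tu; rewrite /chi (trK_double char2) exprMn.
  by move: AF; rewrite inE => /eqP ->; rewrite -mulrDr tu mulr1.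
pose L := [set x : K | x + x ^+ q == 1].
have tI : {in U :\ b &, injective t}.
  move=> u v _ _ /(mulfI b0) /invr_inj; exact: addIr.
have imt : t @: (U :\ b) = L.
  apply/setP => x; rewrite inE; apply/imsetP/eqP => [[u uU ->]|xx]; first exact: tD.
  have x0 : x != 0.
    apply: contra_eq_neq xx => ->.
    by rewrite expr0n expn_eq0 addr0 eq_sym oner_eq0.
  (* Solving x = b / (u + b) gives u = b (1 + x) / x, and 1 + x = x^q on the line. *)
  have ub : b * x ^+ q / x + b = b / x.
    by rewrite -[X in _ + X](mulfK x0 b) -mulrDl -mulrDr [_ + x]addrC xx mulr1.
  exists (b * x ^+ q / x); last by rewrite /t ub invf_div mulrCA divff ?mulr1.
  rewrite in_setD1 -addx_eq0 ub mulf_neq0 ?invr_eq0 //= unitCircleE !exprMn exprVn conjK bq.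
  by rewrite (_ : _ * _ = 1) //; field; rewrite x0 b0 expf_neq0.
rewrite -(big_imset (fun x => chi (A * x)) tI) /= imt.
have [y yF yE] := chi_Fq_nontrivial AF.
apply: eq_opp_int0.
rewrite -{1}(@sum_inj_in _ _ (+%R y)).
- rewrite -mulN1r mulr_sumr.
  by apply: eq_bigr => x _; rewrite mulrDr chiD yE.
- by move=> u v _ _ /addrI.
- move=> x; rewrite !inE conjD; move: yF; rewrite inE => /eqP -> /eqP xx.
  by rewrite addrACA addxx add0r xx.
Qed.

(** The sum T(w) of the overview, of Kloosterman type. *)
Definition kl (w : K) : int := \sum_(u in U) chi (w * u).

(** The Moebius map [phi] permutes U, and 1 / (u + b) is an affine function of [phi u]: the image of
    U under inversion is again a circle. *)
Lemma sum_pole_off_circle a b : b \notin U ->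
  \sum_(u in U) chi (a / (u + b)) =
    chi (a * b ^+ q / (1 + b * b ^+ q)) * kl (a / (1 + b * b ^+ q)).
Proof.
move=> bU; set c := 1 + b * b ^+ q.
have c0 : c != 0 by rewrite addx_eq0 eq_sym -unitCircleE.
have ub0 u : u \in U -> u + b != 0 by move=> uU; rewrite addx_eq0; apply: contraNneq bU => <-.
pose phi u := (1 + b ^+ q * u) / (u + b).
have phiE u : u \in U -> (u + b)^-1 = b ^+ q / c + phi u / c.
  move=> uU; rewrite -mulrDl; apply: (mulIf (ub0 u uU)); rewrite mulVf ?ub0 //.
  have -> : b ^+ q + phi u = c / (u + b); last by rewrite [c / _]mulrC mulfK // mulVf ?ub0.
  apply: (mulIf (ub0 u uU)); rewrite mulrDl /phi !mulfVK ?ub0 //.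
  transitivity ((b ^+ q * u + b ^+ q * u) + (1 + b * b ^+ q)); first by ring.
  by rewrite addxx add0r.
have phiU : {in U, forall u, phi u \in U}.
  move=> u uU; rewrite unitCircleE /phi exprMn exprVn !conjD expr1n exprMn conjK.
  rewrite (unitCircle_conj uU); have u0 := unitCircle_neq0 uU.
  have d0 : 1 + b ^+ q * u != 0.
    (* Conjugating 1 + b^q u = 0 gives 1 + b / u = 0, hence u + b = 0. *)
    apply: contraTneq (ub0 u uU) => /(congr1 (fun x => x ^+ q)).
    rewrite conjD expr1n exprMn conjK (unitCircle_conj uU) expr0n expn_eq0 /= => e.
    have -> : u + b = (1 + b / u) * u by rewrite mulrDl mul1r mulfVK.
    by rewrite e mul0r eqxx.
  apply/eqP; have ub := ub0 u uU; field.
  by rewrite ?u0 ?ub ?d0.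
have phiI : {in U &, injective phi}.
  move=> u v uU vU e; have := phiE u uU; rewrite e -phiE // => /invr_inj; exact: addIr.
rewrite /kl -[in RHS](sum_inj_in (fun u => chi (a / c * u)) phiI phiU) mulr_sumr.
apply: eq_bigr => u uU; rewrite phiE // mulrDr chiD; congr (chi _ * chi _); ring.
Qed.

(** * Parseval and the second and fourth moments of [kl] *)

Lemma parseval (r : K -> int) :
  \sum_w (\sum_s r s * chi (w * s)) ^+ 2 = (q ^ 2)%N%:Z * \sum_s r s ^+ 2.
Proof.
transitivity (\sum_w \sum_s \sum_t r s * r t * chi ((s + t) * w)).
  apply: eq_bigr => w _; rewrite expr2 mulr_suml; apply: eq_bigr => s _.
  rewrite mulr_sumr; apply: eq_bigr => t _.
  by rewrite mulrDl chiD ![_ * w]mulrC; ring.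
rewrite exchange_big mulr_sumr; apply: eq_bigr => s _.
rewrite exchange_big (bigD1 s) //= [X in _ + X]big1 => [|t ts].
  by rewrite -mulr_sumr sum_chi addxx eqxx addr0 mulrC expr2.
by rewrite -mulr_sumr sum_chi addx_eq0 eq_sym (negPf ts) mulr0.
Qed.

Lemma sum_kl2 : \sum_w kl w ^+ 2 = (q ^ 2)%N%:Z * (q + 1)%N%:Z.
Proof.
have := parseval (fun s => (s \in U)%:Z).
have -> : \sum_s ((s \in U)%:Z) ^+ 2 = (q + 1)%N%:Z :> int.
  rewrite -card_unitCircle -sum1_card -natz natr_sum [RHS]big_mkcond /=.
  by apply: eq_bigr => s _; case: (s \in U).
move=> <-; apply: eq_bigr => w _; congr (_ ^+ 2).
by rewrite /kl big_mkcond /=; apply: eq_bigr => u _; case: (u \in U); rewrite ?mul1r ?mul0r.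
Qed.

(** The autocorrelation of the indicator of U, which gives the Fourier coefficients of the square of
    [kl]. *)
Definition circlePairs (s : K) : int := \sum_(u in U) (s + u \in U)%:Z.

Lemma kl_sqr w : kl w ^+ 2 = \sum_s circlePairs s * chi (w * s).
Proof.
transitivity (\sum_(u in U) \sum_s (s + u \in U)%:Z * chi (w * s)).
  rewrite expr2 {1}/kl mulr_suml; apply: eq_bigr => u uU.
  rewrite [RHS](reindex_inj (addIr u)) /= /kl mulr_sumr big_mkcond /=.
  apply: eq_bigr => v _; rewrite -addrA addxx addr0 mulrDr chiD.
  by case: (v \in U); rewrite ?mul0r ?mul1r // mulrC.
by rewrite exchange_big; apply: eq_bigr => s _; rewrite -mulr_suml.
Qed.

Lemma circlePairs_ge0 s : 0 <= circlePairs s.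
Proof. by apply: sumr_ge0. Qed.

Lemma circlePairs0 : circlePairs 0 = (q + 1)%N%:Z.
Proof.
rewrite /circlePairs (@sum_const_set _ _ _ 1) ?card_unitCircle ?mulr1 // => u uU.
by rewrite add0r uU.
Qed.

Lemma sum_circlePairs : \sum_s circlePairs s = (q + 1)%N%:Z ^+ 2.
Proof.
rewrite exchange_big (@sum_const_set _ _ _ (q + 1)%N%:Z) ?card_unitCircle ?expr2 // => u _.
rewrite (reindex_inj (addIr u)) /= -card_unitCircle -sum1_card -natz natr_sum.
rewrite [RHS]big_mkcond /=; apply: eq_bigr => v _; rewrite -addrA addxx addr0.
by case: (v \in U).
Qed.

(* For u, v, z on the circle, (u + v + z) conj(u + v + z) + 1
   equals (u + v)(v + z)(z + u) / (u v z) in characteristic 2. *)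
Lemma unitCircle_sum3 u v z : u \in U -> v \in U -> z \in U -> u + v + z \in U ->
  [|| u == v, v == z | z == u].
Proof.
move=> uU vU zU; rewrite unitCircleE !conjD !unitCircle_conj // => /eqP e.
have [[u0 v0] z0] := (unitCircle_neq0 uU, unitCircle_neq0 vU, unitCircle_neq0 zU).
have : (u + v) * (v + z) * (z + u) == 0; last by rewrite !mulf_eq0 !addx_eq0 -orbA.
apply/eqP; transitivity (u * v * z * ((u + v + z) * (u^-1 + v^-1 + z^-1)) - u * v * z).
  by field; rewrite ?u0 ?v0 ?z0.
by rewrite e mulr1 subrr.
Qed.

(** If u and s + u lie on U, a third solution v would put u + (s + u) + v = s + v on U, a sum of
    three distinct points, against [unitCircle_sum3]. *)
Lemma circlePairs_le2 s : s != 0 -> circlePairs s <= 2.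
Proof.
move=> s0; rewrite /circlePairs.
have [/existsP[u /andP[uU suU]]|/existsPn none] := boolP [exists u, (u \in U) && (s + u \in U)];
  last first.
  by rewrite big1 // => u uU; move: (none u); rewrite uU /= => /negPf ->.
rewrite (bigID (fun v => v \in [set u; s + u])) /= [X in _ + X]big1 ?addr0 => [|v].
  apply: (@le_trans _ _ (\sum_(v in [set u; s + u]) 1)).
    rewrite big_mkcond /= [leRHS]big_mkcond /=; apply: ler_sum => v _.
    by case: (v \in U); case: (v \in [set _; _]) => //=; case: (_ \in U).
  rewrite (@sum_const_set _ _ _ 1) // mulr1 lez_nat cards2.
  by case: (_ != _).
case/andP=> vU; rewrite in_set2 negb_or => /andP[vu vsu].
have e : u + (s + u) = s by rewrite addrCA addxx addr0.
case: (boolP (s + v \in U)) => // svU; have := @unitCircle_sum3 u (s + u) v uU suU vU.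
by rewrite e svU -addx_eq0 e (negPf s0) eq_sym (negPf vsu) (negPf vu) => /(_ isT).
Qed.

(** Parseval applied to [circlePairs]: s = 0 contributes (q+1)^2, and the other s at most twice
    their total q (q+1). *)
Lemma sum_kl4 : \sum_w kl w ^+ 4 <= (q ^ 2)%N%:Z * ((q + 1)%N%:Z * (3 * q%:Z + 1)).
Proof.
have -> : \sum_w kl w ^+ 4 = \sum_w (\sum_s circlePairs s * chi (w * s)) ^+ 2.
  by apply: eq_bigr => w _; rewrite -kl_sqr -exprM.
rewrite parseval ler_wpM2l // (bigD1 0) //= circlePairs0.
have le : \sum_(s | s != 0) circlePairs s ^+ 2 <= 2 * \sum_(s | s != 0) circlePairs s.
  rewrite mulr_sumr; apply: ler_sum => s s0; rewrite expr2 ler_wpM2r ?circlePairs_ge0 //.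
  exact: circlePairs_le2.
apply: le_trans (lerD (lexx _) le) _.
have := sum_circlePairs; rewrite (bigD1 0) //= circlePairs0 => e.
by rewrite (canRL (addKr _) e) PoszD; lia.
Qed.

Lemma kl0 : kl 0 = (q + 1)%N%:Z.
Proof.
rewrite /kl (@sum_const_set _ _ _ 1) ?card_unitCircle ?mulr1 // => u _.
by rewrite mul0r chi0.
Qed.

(** Expand the square over all w, insert both moments, and remove the term at w = 0, which is (q^2 +
    q + 1)^2. *)
Lemma sum_kl_variance :
  \sum_(w | w != 0) (kl w ^+ 2 - q%:Z) ^+ 2 <=
    (q%:Z + 1) * (q%:Z ^+ 3 - q%:Z ^+ 2 - q%:Z - 1).
Proof.
have total : \sum_w (kl w ^+ 2 - q%:Z) ^+ 2 =
    \sum_w kl w ^+ 4 - 2 * q%:Z * \sum_w kl w ^+ 2 + q%:Z ^+ 4.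
  have -> : q%:Z ^+ 4 = \sum_(w : K) q%:Z ^+ 2.
    rewrite sumr_const hK -mulr_natl natz mulnC expnM PoszM; ring.
  rewrite mulr_sumr -sumrB -big_split /=; apply: eq_bigr => w _; ring.
move: total; rewrite (bigD1 0) //= kl0 sum_kl2 => total.
have q2 : (q ^ 2)%N%:Z = q%:Z ^+ 2 by rewrite -mulnn PoszM expr2.
have := sum_kl4; rewrite (canRL (addKr _) total) q2 !PoszD.
by move: (\sum_w _) q%:Z => X Q; lia.
Qed.

(** * Pointwise bounds on [kl] from its symmetries *)

Lemma klM w u : u \in U -> kl (w * u) = kl w.
Proof.
move=> uU; rewrite /kl -[in RHS](@sum_inj_in _ _ ( *%R u)).
- by apply: eq_bigr => v _; rewrite mulrA.
- by move=> x y _ _ /(mulfI (unitCircle_neq0 uU)).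
- by move=> v; apply: unitCircleM.
Qed.

Lemma kl_exp2 w : kl (w ^+ 2) = kl w.
Proof.
rewrite /kl -(@sum_inj_in _ _ (fun u => u ^+ 2)).
- by apply: eq_bigr => u _; rewrite -exprMn chi_sqr.
- move=> x y _ _ /eqP; rewrite eqf_sqr oppx orbb; exact/eqP.
- by move=> v vU; rewrite expr2 unitCircleM.
Qed.

(** The terms of the variance are nonnegative, so those indexed by A may be kept alone. *)
Lemma kl_level_bound (A : {set K}) (t : int) :
    0 \notin A -> {in A, forall w, kl w = t} ->
  #|A|%:Z * (t ^+ 2 - q%:Z) ^+ 2 <= (q%:Z + 1) * (q%:Z ^+ 3 - q%:Z ^+ 2 - q%:Z - 1).
Proof.
move=> A0 At; apply: le_trans sum_kl_variance.
rewrite -(@sum_const_set _ _ (fun w => (kl w ^+ 2 - q%:Z) ^+ 2)) => [|w /At -> //].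
rewrite big_mkcond [leRHS]big_mkcond /=; apply: ler_sum => w _.
case: ifP => wA; last by case: ifP => _ //; rewrite sqr_ge0.
by rewrite ifT //; apply: contraNneq A0 => <-.
Qed.

(** The level set w U has q + 1 elements, which cancels the factor q + 1 of the variance bound. *)
Lemma kl_bound w : w != 0 ->
  (kl w ^+ 2 - q%:Z) ^+ 2 <= q%:Z ^+ 3 - q%:Z ^+ 2 - q%:Z - 1.
Proof.
move=> w0; have := @kl_level_bound [set w * u | u in U] (kl w).
rewrite card_imset ?card_unitCircle ?PoszD; last exact: mulfI.
rewrite ler_pM2l; last by lia.
apply; last by move=> _ /imsetP[u uU ->]; rewrite klM.
apply/imsetP => -[u uU /esym/eqP]; rewrite mulf_eq0 (negPf w0) /=.
by rewrite (negPf (unitCircle_neq0 uU)).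
Qed.

(* Frobenius invariance: w U and w^2 U are two disjoint level cosets unless w is on the circle. *)
Lemma kl_bound_off_circle w : w != 0 -> w \notin U ->
  2 * (kl w ^+ 2 - q%:Z) ^+ 2 <= q%:Z ^+ 3 - q%:Z ^+ 2 - q%:Z - 1.
Proof.
move=> w0 wU; pose A z : {set K} := [set z * u | u in U].
have cA z : z != 0 -> #|A z| = (q + 1)%N.
  by move=> z0; rewrite card_imset ?card_unitCircle //; exact: mulfI.
have nA z : z != 0 -> 0 \notin A z.
  move=> z0; apply/imsetP => -[u uU /esym/eqP]; rewrite mulf_eq0 (negPf z0) /=.
  by rewrite (negPf (unitCircle_neq0 uU)).
have w20 : w ^+ 2 != 0 by rewrite expf_neq0.
have := @kl_level_bound (A w :|: A (w ^+ 2)) (kl w).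
rewrite cardsU disjoint_setI0 ?cards0 ?subn0 ?cA //.
  rewrite [X in X * _](_ : _ = (q%:Z + 1) * 2); last by lia.
  rewrite -mulrA ler_pM2l; last by lia.
  apply; first by rewrite in_setU negb_or !nA.
  by move=> z /setUP[] /imsetP[u uU ->]; rewrite klM ?kl_exp2.
rewrite disjoints_subset; apply/subsetP => z /imsetP[u uU ->]; rewrite inE.
(* If w u = w^2 v with u, v on U, then w = u / v is on U. *)
apply: contra wU => /imsetP[v vU]; rewrite expr2 -mulrA => /(mulfI w0) uE.
by rewrite -(mulfK (unitCircle_neq0 vU) w) -uE unitCircleM ?unitCircleV.
Qed.

(** Here U is cyclic of order 65 and [chi] is invariant under squaring, so each doubling orbit of
    exponents carries one sign; the leading 1 is [chi 1]. *)
Lemma kl1_n6 : n = 6%N -> exists x13 x1 x3 x5 x7 x11 : K,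
  kl 1 = 1 + 4 * chi x13 + 12 * (chi x1 + chi x3 + chi x5 + chi x7 + chi x11).
Proof.
move=> n6; have qE : (q + 1 = 65)%N by rewrite n6.
have d65 : (65 %| #|K|.-1)%N by rewrite card_predE qE dvdn_mull.
have [g gP] := finField_dvd_prim_root d65.
have gU : [set g ^+ (i : 'I_65) | i : 'I_65] = U.
  apply/setP => x; rewrite inE qE; apply/imsetP/eqP.
    by move=> [i _ ->]; rewrite exprAC (prim_expr_order gP) expr1n.
  by move=> /(prim_rootP gP)[i ->]; exists i.
exists (g ^+ 13), (g ^+ 1), (g ^+ 3), (g ^+ 5), (g ^+ 7), (g ^+ 11).
rewrite /kl -gU big_imset /=; last first.
  by move=> i j _ _ /eqP; rewrite (eq_prim_root_expr gP) !modn_small // => /eqP/val_inj.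
under eq_bigr do rewrite mul1r.
rewrite (@doubling_orbits_mod65 (fun i => chi (g ^+ i))) => [|i|i].
- by rewrite expr0 chi_Fq // inE expr1n.
- by rewrite (prim_expr_mod gP).
- by rewrite mulnC exprM chi_sqr.
Qed.

Lemma kl_small w : (5 < n)%N -> w != 0 -> 3 * `|kl w| < q%:Z - 1.
Proof.
move=> n6 w0; rewrite ltNge; apply/negP => le.
have kk : kl w ^+ 2 = `|kl w| ^+ 2 by rewrite real_normK ?num_real.
have t0 : 0 <= `|kl w| by [].
have [n7|] := ltnP 6 n.
  have q7 : 128 <= q%:Z by rewrite -[128]/(2 ^ 7)%N%:Z lez_nat leq_exp2l.
  have := kl_bound w0; rewrite kk; have := sqr_gap q7 t0 le.
  have : 0 <= q%:Z ^+ 2 by rewrite sqr_ge0.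
  by lia.
move=> n6'; have nE : n = 6%N by lia.
have qE : q%:Z = 64 by rewrite nE.
rewrite qE in le.
(* Off the circle, t >= 21 gives 2 * 377^2 = 284258, above 64^3 - 64^2 - 65 = 257983. *)
have [wU|wU] := boolP (w \in U); last first.
  have := kl_bound_off_circle w0 wU; rewrite kk qE.
  have : 21 <= `|kl w| by lia.
  by move: `|kl w| => t; nia.
have {}wU : kl w = kl 1 by rewrite -[w]mul1r klM.
have := kl_bound (oner_neq0 K); rewrite -wU kk qE.
have [x13 [x1 [x3 [x5 [x7 [x11 e]]]]]] := kl1_n6 nE.
(* The variance bound leaves only 21 <= t <= 23, while the values 1 +- 4 + 12 k with k odd all avoid
   this range. *)
have : `|kl w| <= 23 -> False.
  move: le; rewrite wU e.
  by case: (chi_pm x13) => ->; case: (chi_pm x1) => ->; case: (chi_pm x3) => ->;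
     case: (chi_pm x5) => ->; case: (chi_pm x7) => ->; case: (chi_pm x11) => ->; lia.
by move: `|kl w| => t; nia.
Qed.

(** * The circle sum of a product, and its reduction to signs *)

Lemma circleSum_and a1 a2 b :
  2 * circleSum (fun u => (trK 1 (2 * n) (a1 / (u + b)) == 1)
                          && (trK 1 (2 * n) (a2 / (u + b)) == 1)) =
  q%:Z + 1 + \sum_(u in U) chi (a1 / (u + b)) + \sum_(u in U) chi (a2 / (u + b))
    - \sum_(u in U) chi ((a1 + a2) / (u + b)).
Proof.
have -> : q%:Z + 1 = \sum_(u in U) 1.
  by rewrite (@sum_const_set _ _ _ 1) // card_unitCircle PoszD mulr1.
rewrite -!big_split -sumrB mulr_sumr; apply: eq_bigr => u _.
(* Pointwise, 2 (-1)^(xy) = 1 + (-1)^x + (-1)^y - (-1)^(x+y). *)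
by rewrite /= [(a1 + a2) / _]mulrDl chiD /chi; do 2!case: (_ == 1).
Qed.

(** Three sums of size below (q - 1) / 3 leave 2 S > q + 1 - (q - 1) = 2, while the claim would make
    2 S equal to 2 or -2. *)
Lemma circleSum_off_circle a1 a2 b (e : bool) :
    (5 < n)%N -> a1 != 0 -> a2 != 0 -> a1 != a2 -> b \notin U ->
  circleSum (fun u => (trK 1 (2 * n) (a1 / (u + b)) == 1)
                      && (trK 1 (2 * n) (a2 / (u + b)) == 1)) <> (-1) ^+ e.
Proof.
move=> n6 a10 a20 a12 bU E; have := circleSum_and a1 a2 b; rewrite E.
have c0 : 1 + b * b ^+ q != 0 by rewrite addx_eq0 eq_sym -unitCircleE.
have small a : a != 0 -> 3 * `|\sum_(u in U) chi (a / (u + b))| < q%:Z - 1.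
  move=> a0; rewrite sum_pole_off_circle // normrM normr_chi mul1r.
  by rewrite kl_small // mulf_neq0 // invr_eq0.
have a120 : a1 + a2 != 0 by rewrite addx_eq0.
have := small _ a10; have := small _ a20; have := small _ a120.
move: (\sum_(u in U) _) (\sum_(u in U) _) (\sum_(u in U) _) => x y z.
by case: e {E} => /=; lia.
Qed.

(** Chosen so that, for b on U, the sum S(a) is 1 + q [FqSign (a * b ^+ q)]. *)
Definition FqSign (x : K) : int := if x \in Fq then (-1) ^+ (trK 1 n x == 1) else 0.

(** Here 2 S - 2 is q times an integer, while S = 1 or -1 makes it 0 or -4; as q >= 64 it is 0. *)
Lemma circleSum_on_circle a1 a2 b (e : bool) : (5 < n)%N -> b \in U ->
  circleSum (fun u => (trK 1 (2 * n) (a1 / (u + b)) == 1)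
                      && (trK 1 (2 * n) (a2 / (u + b)) == 1)) = (-1) ^+ e <->
  e = false /\ 1 + FqSign (a1 * b ^+ q) + FqSign (a2 * b ^+ q)
                 = FqSign ((a1 + a2) * b ^+ q).
Proof.
move=> n6 bU; have := circleSum_and a1 a2 b; rewrite !sum_pole_on_circle //.
have P x : (if x \in Fq then q%:Z * (-1) ^+ (trK 1 n x == 1) else 0) = q%:Z * FqSign x.
  by rewrite /FqSign; case: ifP; rewrite ?mulr0.
rewrite !P; have q64 : 64 <= q%:Z by rewrite -[64]/(2 ^ 6)%N%:Z lez_nat leq_exp2l.
move: q%:Z (circleSum _) (FqSign (a1 * _)) (FqSign (a2 * _)) (FqSign ((a1 + a2) * _)) q64.
move=> Q S x y z Q64 SE.
have {}SE : 2 * S - 2 = Q * (1 + x + y - z) by lia.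
split=> [S1|[-> xyz]]; last first.
  by move: SE; rewrite xyz subrr mulr0 expr0; lia.
suff D0 : 1 + x + y - z = 0.
  by rewrite D0 mulr0 in SE; case: e S1 => /= S1; split=> //; lia.
have : `|Q * (1 + x + y - z)| <= 4 by rewrite -SE S1; case: (e) => /=; lia.
by rewrite normrM; move: (1 + x + y - z) => d; nia.
Qed.

(** Since a b^q is its own conjugate, its square is its norm, which is a a^q because b has norm
    1. *)
Lemma trK_norm a b : b \in U -> a * b ^+ q \in Fq ->
  trK 1 n (a * a ^+ q) = trK 1 n (a * b ^+ q).
Proof.
move=> bU; rewrite inE => /eqP AF; rewrite -[RHS](trK_sqr AF); congr trK.
have bb : b * b ^+ q = 1 by apply/eqP; rewrite -unitCircleE.
by rewrite -[_ ^+ 2]/(_ * _) -{2}AF exprMn conjK mulrACA [b ^+ q * b]mulrC bb mulr1.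
Qed.

Lemma trK_rel2_eq0 (x : K) : trK n 2 x = 0 <-> x \in Fq.
Proof.
rewrite /trK big_ord_recr big_ord1 /= muln0 expn0 muln1 inE eq_sym -addx_eq0 expr1.
by split=> /eqP.
Qed.

Lemma FqSign_eq1 x : 1 = FqSign x <-> x \in Fq /\ trK 1 n x = 0.
Proof.
rewrite /FqSign; case: ifP => xF; last by split=> // -[].
by case: (tr_n_01 xF) => ->; rewrite ?eqxx ?[0 == 1]eq_sym ?oner_eq0; split=> // -[_ /eqP];
  rewrite oner_eq0.
Qed.

Lemma FqSign_eqN1 x : 1 + FqSign x = 0 <-> x \in Fq /\ trK 1 n x = 1.
Proof.
rewrite /FqSign; case: ifP => xF; last by split=> // -[].
by case: (tr_n_01 xF) => ->; rewrite ?eqxx ?[0 == 1]eq_sym ?oner_eq0; split=> // -[_ /eqP];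
  rewrite eq_sym oner_eq0.
Qed.

End Character.

Theorem theorem2 (n : nat) (K : finFieldType) (hK : #|K| = (2 ^ (2 * n))%N)
    (hn : (6 <= n)%N) (a1 a2 b : K)
    (ha1 : a1 != 0) (ha1q : a1 ^+ (2 ^ n) = a1)
    (ha2 : a2 != 0) (hb : b != 0) (ha12 : a1 != a2) :
  let q := (2 ^ n)%N in
  let conj (x : K) := x ^+ q in
  let inU (x : K) := x ^+ (q + 1) = 1 in
  let f1 := fab n a1 b in
  let f2 := fab n a2 b in
  let h2 := fun x : K => f1 x && f2 x in
  bent (2 * n) h2 <->
  [\/ (b = 1 /\ trK 1 n a1 = 1 /\ conj a2 != a2),
      (inU b /\ b != 1 /\ trK n 2 (a2 * conj b) = 0
         /\ trK 1 n (a2 * conj a2) = 1 /\ h2 0 = false)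
    | (inU b /\ b != 1 /\ trK n 2 ((a1 + a2) * conj b) = 0
         /\ trK 1 n ((a1 + a2) * (a1 + conj a2)) = 0 /\ h2 0 = false)].
Proof.
move=> q conj inU f1 f2 h2.
have n_gt0 : (0 < n)%N by lia.
have n_gt1 : (1 < n)%N by lia.
pose Fq := subFq K n; pose U := unitCircle K n.
have inUP x : inU x <-> x \in U by rewrite inE; split=> /eqP.
have a1F : a1 \in Fq by rewrite inE ha1q.
pose G u := (trK 1 (2 * n) (a1 / (u + b)) == 1) && (trK 1 (2 * n) (a2 / (u + b)) == 1).
apply: iff_trans (@bent_circleSum _ _ hK n_gt0 h2 G (fun _ _ => erefl _) n_gt1) _.
have [bU|bU] := boolP (b \in U); last first.
  split=> [E|]; first by case: (circleSum_off_circle hK n_gt0 hn ha1 ha2 ha12 bU E).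
  have nU : ~ inU b by move/inUP; apply/negP.
  by case=> [[b1]|[/nU]|[/nU]] //; rewrite b1 unitCircle1 in bU.
apply: iff_trans (circleSum_on_circle hK n_gt0 a1 a2 (h2 0) hn bU) _.
have [b1|b1] := eqVneq b 1.
  (* At x = 0 the first factor is the absolute trace of a1, which vanishes because a1 is in F_q. *)
  have h20 : h2 0 = false.
    rewrite /h2 /f1 /fab b1 expr0n subn_eq0 leqNgt (q_gt1 n_gt0) add0r divr1.
    by rewrite (trK_double (char2 hK)) ha1q (addxx hK) trK0 eq_sym oner_eq0.
  rewrite h20 b1 expr1n !mulr1.
  have a12F : (a1 + a2 \in Fq) = (a2 \in Fq).
    by apply/idP/idP => [/(FqD hK a1F)|]; [rewrite (addKx hK)|apply: FqD].
  (* With a2 in F_q the equation reads 1 + s1 + s2 = s1 s2 for two signs, which is impossible.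
     Otherwise the signs of a2 and a1 + a2 are 0, leaving condition (1). *)
  have [a2F|a2F] := boolP (a2 \in Fq).
    split=> [[_]|].
      rewrite /FqSign -/Fq a12F a1F a2F (trKD (char2 hK)).
      by case: (tr_n_01 hK a1F) => ->; case: (tr_n_01 hK a2F) => ->;
        rewrite ?addr0 ?add0r ?(addxx hK) ?eqxx ?[0 == 1]eq_sym ?oner_eq0.
    case=> [[_ [_]]|[_ []]|[_ []]] //.
    by move: a2F; rewrite inE /conj => ->.
  rewrite {2}/FqSign {2}/FqSign -/Fq a12F (negPf a2F) addr0.
  rewrite inE in a2F.
  split=> [[_ /(FqSign_eqN1 hK)[_ t1]]|]; first by apply: Or31.
  by case=> [[_ [t1 _]]|[_ []]|[_ []]] //; split=> //; apply/(FqSign_eqN1 hK).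
have bF : b \notin Fq by apply: contra b1 => /(Fq_unitCircle hK bU) ->.
(* Dividing by a1 would put b^q, hence b, in F_q; so the sign attached to a1 is 0. *)
have A1F : a1 * b ^+ q \notin Fq.
  apply: contra bF => /(FqM (FqV a1F)); rewrite mulrA mulVf // mul1r !inE.
  by rewrite (conjK hK) eq_sym.
rewrite {1}/FqSign -/Fq (negPf A1F) addr0.
have AD : (a1 + a2) * b ^+ q = a1 * b ^+ q + a2 * b ^+ q by rewrite mulrDl.
have conj12 : a1 + conj a2 = (a1 + a2) ^+ q by rewrite (conjD hK) ha1q.
rewrite conj12.
(* The two remaining arguments differ by a1 b^q, so at most one is in F_q. If it is a2 b^q, the
   equation becomes 1 + [FqSign] = 0, which is condition (2). *)
have [A2F|A2F] := boolP (a2 * b ^+ q \in Fq).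
  have A12F : (a1 + a2) * b ^+ q \notin Fq.
    apply: contra A1F => /(FqD hK)/(_ A2F).
    by rewrite AD -addrA (addxx hK) addr0.
  rewrite {2}/FqSign -/Fq (negPf A12F).
  split=> [[h20 /(FqSign_eqN1 hK)[_ t1]]|].
    apply: Or32; rewrite (trK_norm hK bU A2F); do !split=> //; first exact/inUP.
    exact/(trK_rel2_eq0 hK).
  case=> [[b1' _]|[_ [_ [_ [t1 ->]]]]|[_ [_ [/(trK_rel2_eq0 hK) F _]]]].
  - by rewrite b1' eqxx in b1.
  - by split=> //; apply/(FqSign_eqN1 hK); split=> //; rewrite -(trK_norm hK bU A2F).
  - by rewrite F in A12F.
(* Now the equation is 1 = [FqSign ((a1 + a2) * b ^+ q)], which is condition (3) after
   [trK_norm]. *)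
rewrite {1}/FqSign -/Fq (negPf A2F) addr0.
split=> [[h20 /(FqSign_eq1 hK)[F t0]]|].
  apply: Or33; rewrite (trK_norm hK bU F); do !split=> //; first exact/inUP.
  exact/(trK_rel2_eq0 hK).
case=> [[b1' _]|[_ [_ [/(trK_rel2_eq0 hK) F _]]]|[_ [_ [/(trK_rel2_eq0 hK) F [t0 ->]]]]].
- by rewrite b1' eqxx in b1.
- by rewrite F in A2F.
- by split=> //; apply/(FqSign_eq1 hK); split=> //; rewrite -(trK_norm hK bU F).
Qed.
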